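(* Let $G$ be any graph with $n$ vertices. Then the stable set polytope $\mathrm{STAB}(G)$ does not admit an $\mathcal{S}_+^n$-lift.
   Context: $\mathcal{S}_+^n$ is the cone of $n\times n$ real symmetric positive semidefinite matrices, inside the space of $n \times n$ real symmetric matrices. For a convex set $C\subset\mathbb{R}^d$, an $\mathcal{S}_+^k$-lift of $C$ is a set $\mathcal{S}_+^k\cap L$, with $L$ an affine subspace of the space of $k\times k$ real symmetric matrices, together with a linear map $\pi$ from that space to $\mathbb{R}^d$ such that $C=\pi(\mathcal{S}_+^k\cap L)$. For a graph $G$ with vertex set $V=\{1,\dots,n\}$ and edge set $E$, a subset $S\subseteq V$ is stable if there are no edges between elements of $S$; $\chi_S\in\{0,1\}^n$ is its characteristic vector, $(\chi_S)_i=1$ iff $i\in S$. The stable set polytope is $\mathrm{STAB}(G)=\mathrm{conv}\{\chi_S : S \text{ is a stable set of } G\}\subset\mathbb{R}^n$. *)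

(* Defs.v *)
From HB Require Import structures.
From mathcomp Require Import all_boot all_order all_algebra.
From mathcomp Require Import boolp classical_sets reals convex.

Set Implicit Arguments.
Unset Strict Implicit.
Unset Printing Implicit Defensive.

Import Order.TTheory GRing.Theory Num.Theory.

Local Open Scope classical_set_scope.
Local Open Scope ring_scope.

Section SymmetricMatrices.
Variables (R : realType) (k : nat).

Definition symmx_pred : {pred 'M[R]_k} := fun A => A \is symmetricmx.

Lemma symmx_predE (A : 'M[R]_k) : (A \in symmx_pred) = (A^T == A).
Proof.
by rewrite unfold_in is_hermitianmxE expr0 scale1r map_mx_id // eq_sym.
Qed.

Fact symmx_submod_closed : submod_closed symmx_pred.
Proof.
split=> [|a A B]; rewrite !symmx_predE; first by rewrite trmx0.
by move=> /eqP hA /eqP hB; rewrite linearP /= hA hB.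
Qed.

HB.instance Definition _ :=
  GRing.isSubmodClosed.Build R 'M[R]_k symmx_pred symmx_submod_closed.

Record symmx := SymMx { symmx_val :> 'M[R]_k; _ : symmx_val \in symmx_pred }.

HB.instance Definition _ := [isSub for symmx_val].
HB.instance Definition _ := [Choice of symmx by <:].
HB.instance Definition _ := [SubChoice_isSubLmodule of symmx by <:].

Lemma symmx_trmx (A : symmx) : A^T = A :> 'M[R]_k.
Proof. by apply/eqP; rewrite -symmx_predE; case: A. Qed.

Definition psd_cone : set symmx :=
  [set A | forall x : 'cV[R]_k, 0 <= (x^T *m A *m x) 0 0].

End SymmetricMatrices.

Arguments psd_cone : clear implicits.

(* The empty set counts as an affine subspace here; it can only be used to lift
   the empty set. *)
Definition affine_subspace (R : realType) (V : lmodType R) (L : set V) : Prop :=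
  forall (x y : V) (t : R), L x -> L y -> L ((1 - t) *: x + t *: y).

Definition has_psd_lift (R : realType) (d k : nat) (C : set 'rV[R]_d) : Prop :=
  exists (L : set (symmx R k)) (pi : {linear symmx R k -> 'rV[R]_d}),
    affine_subspace L /\ C = pi @` (psd_cone R k `&` L).

Definition convex_hull (R : realType) (V : lmodType R) (S : set V) : set V :=
  smallest (@convex_set R V) S.

(* A graph on 'I_n is given by its adjacency relation e. *)
Definition stable_set (n : nat) (e : rel 'I_n) (S : {set 'I_n}) : Prop :=
  {in S &, forall i j, ~~ e i j}.

Definition char_vec (R : realType) (n : nat) (S : {set 'I_n}) : 'rV[R]_n :=
  \row_i (i \in S)%:R.

Definition STAB (R : realType) (n : nat) (e : rel 'I_n) : set 'rV[R]_n :=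
  convex_hull [set char_vec R S | S in [set S | stable_set e S]].

Arguments STAB R {n} e.

(* Main.v *)
(** The faces [STAB G `&` [set x | x_j = 0 for all j < i]], for [i] from [0] to
    [n], strictly decrease from [STAB G] to the vertex [0], because of the unit
    vectors.  Their preimages in the slice of the PSD cone are faces of the
    slice, and the maximal rank strictly drops along a strict chain of faces:
    a matrix whose row space contains that of [A] can be extrapolated slightly
    away from [A] inside the slice.  Hence a matrix over the vertex [0] has
    rank at most [n - n = 0], so [L] contains [0], the slice is a cone, and so
    is its projection.  But [STAB G] is bounded and not reduced to [0]. *)

Require Import Defs.
From mathcomp Require Import all_boot all_order all_algebra.
From mathcomp Require Import boolp classical_sets reals convex.
From mathcomp Require Import interval_inference ring lra.

Import Order.TTheory GRing.Theory Num.Theory.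

(** * Quadratic forms, row spaces and ranks of PSD matrices *)

Section QuadraticForm.
Local Open Scope ring_scope.
Variables (R : realType) (k : nat).
Implicit Types (P A : symmx R k) (x : 'cV[R]_k).

Definition qform (M : 'M[R]_k) x : R := (x^T *m M *m x) 0 0.

Lemma qformD (M N : 'M[R]_k) x (a b : R) :
  qform (a *: M + b *: N) x = a * qform M x + b * qform N x.
Proof.
by rewrite /qform mulmxDr mulmxDl -!scalemxAr -!scalemxAl !mxE.
Qed.

Lemma symmx_val_lin P A (a b : R) :
  symmx_val (a *: P + b *: A) = a *: symmx_val P + b *: symmx_val A.
Proof. by []. Qed.

Lemma qform_delta (M : 'M[R]_k) i : qform M (delta_mx i 0) = M i i.
Proof. by rewrite /qform trmx_delta -rowE -colE !mxE. Qed.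

Lemma qform_delta_lin A x i (s t : R) :
  qform A (s *: delta_mx i 0 + t *: x) =
  s ^+ 2 * A i i + 2 * (s * t * (symmx_val A *m x) i 0) + t ^+ 2 * qform A x.
Proof.
have E1 : ((delta_mx i 0 : 'cV[R]_k)^T *m A *m x) 0 0
          = (symmx_val A *m x) i 0.
  by rewrite trmx_delta -mulmxA -rowE mxE.
have E2 : (x^T *m A *m (delta_mx i 0 : 'cV[R]_k)) 0 0
          = (symmx_val A *m x) i 0.
  rewrite -E1 -[_ *m _ *m delta_mx _ _]trmxK [LHS]mxE !trmx_mul trmxK.
  by rewrite symmx_trmx mulmxA.
rewrite -qform_delta /qform [(_ + _)^T]linearD /= ![(_ *: _)^T]linearZ /=.
rewrite mulmxDl !mulmxDr !mulmxDl.
rewrite -!scalemxAl -!scalemxAr ![(_ + _ : 'M_(_, _)) 0 0]mxE.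
rewrite ![(_ *: _ : 'M_(_, _)) 0 0]mxE E1 E2.
lra.
Qed.

(** On the span of the [i]-th unit vector and [x], the form is a nonnegative binary quadratic form,
    so its discriminant is at most 0. *)
Lemma psd_cauchy_schwarz A x i : psd_cone R k A ->
  (symmx_val A *m x) i 0 ^+ 2 <= A i i * qform A x.
Proof.
move=> psdA.
set b := (symmx_val A *m x) i 0; set a := A i i; set c := qform A x.
have H (s t : R) : 0 <= s ^+ 2 * a + 2 * (s * t * b) + t ^+ 2 * c.
  by rewrite -qform_delta_lin; exact: psdA.
have a0 : 0 <= a by rewrite /a -qform_delta; exact: psdA.
have c0 : 0 <= c by exact: psdA.
have [a_eq0|a_neq0] := eqVneq a 0.
  have [->|b_neq0] := eqVneq b 0; first by rewrite expr0n /= mulr_ge0.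
  (* With [a = 0] and [t = 1] the form is affine in [s], and here it takes the value
     [- c - 2 < 0]. *)
  have := H (- (c + 1) / b) 1.
  rewrite a_eq0 mulr1 mulfVK//; lra.
have a_gt0 : 0 < a by rewrite lt_neqAle eq_sym a_neq0.
have := H (- b) a.
have -> : (- b) ^+ 2 * a + 2 * (- b * a * b) + a ^+ 2 * c
          = a * (a * c - b ^+ 2) by ring.
by rewrite pmulr_rge0// subr_ge0.
Qed.

Lemma psd_diag_ge0 A i : psd_cone R k A -> 0 <= A i i.
Proof. by move=> psdA; rewrite -qform_delta; exact: psdA. Qed.

Lemma psd_qform_eq0 A x : psd_cone R k A -> qform A x = 0 ->
  symmx_val A *m x = 0.
Proof.
move=> psdA Ax0; apply/matrixP => i j; rewrite ord1 [RHS]mxE.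
apply/eqP; rewrite -sqrf_eq0 eq_le sqr_ge0 andbT.
by have := psd_cauchy_schwarz A x i psdA; rewrite Ax0 mulr0.
Qed.

(** Cauchy-Schwarz bounds each squared entry of [P *m x], since a diagonal entry is at most the
    trace; products then follow from [2|uv| <= u^2 + v^2]. *)
Lemma psd_mul_bound P x i j : psd_cone R k P ->
  `|(symmx_val P *m x) i 0 * (symmx_val P *m x) j 0| <= \tr P * qform P x.
Proof.
move=> psdP.
have B l : (symmx_val P *m x) l 0 ^+ 2 <= \tr P * qform P x.
  apply: le_trans (psd_cauchy_schwarz P x l psdP) _.
  apply: ler_wpM2r; first exact: psdP.
  rewrite /mxtrace (bigD1 l) //= lerDl sumr_ge0 // => m _.
  exact: psd_diag_ge0.
move: (B i) (B j) => Bi Bj.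
rewrite ler_norml; apply/andP; split.
  have := sqr_ge0 ((symmx_val P *m x) i 0 + (symmx_val P *m x) j 0); nra.
have := sqr_ge0 ((symmx_val P *m x) i 0 - (symmx_val P *m x) j 0); nra.
Qed.

(** The inclusion and symmetry give [A = P Z P], so the form of [A] at [x] is that of [Z] at
    [P *m x], whose products of entries are controlled by [qform P x]. *)
Lemma psd_submx_bound P A : psd_cone R k P -> (symmx_val A <= symmx_val P)%MS ->
  exists2 M : R, 0 <= M & forall x, qform A x <= M * qform P x.
Proof.
move=> psdP sAP.
have [Y AYP] : exists Y, symmx_val A *m Y *m symmx_val P = A.
  by exists (pinvmx (symmx_val P)); exact: mulmxKpV.
pose Z := Y^T *m A *m Y.
(* Transposing [A = A Y P] gives [A = P Y^T A], which is substituted for the [A] on the right. *)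
have AE : symmx_val A = symmx_val P *m Z *m symmx_val P.
  rewrite /Z !mulmxA -[in LHS]AYP; congr (_ *m _ *m _).
  by rewrite -[LHS]symmx_trmx -[in LHS]AYP !trmx_mul !symmx_trmx mulmxA.
exists ((\sum_j \sum_i `|Z i j|) * \tr P).
  apply: mulr_ge0; first by do 2!(apply: sumr_ge0 => ? _).
  by apply: sumr_ge0 => i _; exact: psd_diag_ge0.
move=> x; rewrite -mulrA /qform [in X in X <= _]AE -/(qform P x).
have := psd_mul_bound P x; move: (\tr P * qform P x) => T.
have -> : x^T *m (symmx_val P *m Z *m symmx_val P) *m x =
    (symmx_val P *m x)^T *m Z *m (symmx_val P *m x).
  by rewrite trmx_mul symmx_trmx !mulmxA.
move: (symmx_val P *m x) => w wT.
rewrite mxE mulr_suml; apply: ler_sum => j _.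
rewrite mxE !mulr_suml; apply: ler_sum => i _.
apply: le_trans (ler_norm _) _.
by rewrite [w^T _ _]mxE mulrAC normrM mulrC ler_wpM2l // wT.
Qed.

Lemma psd_extrapolate P A : psd_cone R k P -> (symmx_val A <= symmx_val P)%MS ->
  exists2 t : R, t < 0 & psd_cone R k ((1 - t) *: P + t *: A).
Proof.
move=> psdP /(psd_submx_bound _ _ psdP)[M M0 qAP].
have M1 : 0 < M + 1 by lra.
(* With [s = 1 / (M + 1)] one has [s M = 1 - s], so the new form is at least
   [(1 + s) q - s M q = 2 s q], where [q = qform P x]. *)
exists (- (M + 1)^-1); first by rewrite oppr_lt0 invr_gt0.
move=> x; rewrite symmx_val_lin -/(qform _ x) qformD opprK.
have := psdP x; rewrite -/(qform P x) => qP0.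
have t0 : 0 < (M + 1)^-1 by rewrite invr_gt0.
have tM : (M + 1)^-1 * (M + 1) = 1 by rewrite mulVf // gt_eqF.
have := ler_wpM2l (ltW t0) (qAP x).
set t := (M + 1)^-1 in t0 tM *; move: (qAP x) qP0.
set q := qform P x; set r := qform A x => qr q0 tqr.
have tM1 : t * M = 1 - t by move: tM; rewrite mulrDr mulr1; lra.
by move: tqr (mulr_ge0 (ltW t0) q0); rewrite mulrA tM1; lra.
Qed.

Lemma psd_conv P A (t : R) : 0 <= t <= 1 ->
  psd_cone R k P -> psd_cone R k A -> psd_cone R k ((1 - t) *: P + t *: A).
Proof.
move=> /andP[t0 t1] psdP psdA x; rewrite symmx_val_lin -/(qform _ x) qformD.
by rewrite addr_ge0 // mulr_ge0 ?subr_ge0 //; [exact: psdP|exact: psdA].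
Qed.

(** The columns of [cokermx N] lie in the kernel of [N], so [M] kills them too. *)
Lemma submx_of_kernel (M N : 'M[R]_k) :
  (forall x : 'cV[R]_k, N *m x = 0 -> M *m x = 0) -> (M <= N)%MS.
Proof.
move=> ker; rewrite submxE; apply/eqP/matrixP => i j.
have : M *m (cokermx N *m (delta_mx j 0 : 'cV_k)) = 0.
  by apply: ker; rewrite mulmxA mulmx_coker mul0mx.
by rewrite mulmxA -colE => /matrixP/(_ i 0); rewrite mxE => ->; rewrite !mxE.
Qed.

(** On the kernel of the combination, two nonnegative terms sum to 0, so both forms vanish there,
    and hence so do [P *m x] and [A *m x]. *)
Lemma psd_submx_conv P A (t : R) : 0 < t < 1 ->
  psd_cone R k P -> psd_cone R k A ->
  (symmx_val P <= symmx_val ((1 - t) *: P + t *: A)%R)%MS /\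
  (symmx_val A <= symmx_val ((1 - t) *: P + t *: A)%R)%MS.
Proof.
move=> /andP[t0 t1] psdP psdA; set Q := (1 - t) *: P + t *: A.
have ker x : symmx_val Q *m x = 0 ->
    symmx_val P *m x = 0 /\ symmx_val A *m x = 0.
  move=> Qx.
  have : qform Q x = 0 by rewrite /qform -mulmxA Qx mulmx0 mxE.
  rewrite symmx_val_lin qformD => /eqP.
  have := psdP x; have := psdA x; rewrite -!/(qform _ x) => qA qP.
  rewrite paddr_eq0 ?mulr_ge0 ?subr_ge0 ?(ltW t0) ?(ltW t1) //.
  rewrite !mulf_eq0 subr_eq0 (gt_eqF t0) (gt_eqF t1) /= => /andP[/eqP ? /eqP ?].
  by split; exact: psd_qform_eq0.
by split; apply: submx_of_kernel => x /ker[].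
Qed.

Lemma face_rank_ltn d (L : set (symmx R k)) (pi : {linear symmx R k -> 'rV[R]_d})
    (i : 'I_d) P A :
  affine_subspace L -> (forall Q, psd_cone R k Q -> L Q -> 0 <= pi Q 0 i) ->
  psd_cone R k P -> L P -> pi P 0 i = 0 ->
  psd_cone R k A -> L A -> 0 < pi A 0 i ->
  (\rank (symmx_val P) <
     \rank (symmx_val ((1 - 2^-1) *: P + 2^-1 *: A)%R))%N.
Proof.
move=> affL pi_ge0 psdP LP piP psdA LA piA.
have half : 0 < (2^-1 : R) < 1 by apply/andP; split; lra.
have [sP sA] := psd_submx_conv P A _ half psdP psdA.
(* Otherwise the row space of [P] contains that of [A], and moving from [P] away from [A] stays in
   the slice but makes coordinate [i] negative. *)
apply: rank_ltmx; rewrite ltmxE sP /=; apply/negP => sQP.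
have [t t0 psdQ] := psd_extrapolate P A psdP (submx_trans sA sQP).
have := pi_ge0 _ psdQ (affL P A t LP LA).
rewrite linearD /= !linearZ /= !mxE piP; nra.
Qed.

End QuadraticForm.

(** * Ranks along the chain of faces of a lift *)

Section Lift.
Local Open Scope ring_scope.
Variables (R : realType) (k d : nat) (L : set (symmx R k)).
Variable pi : {linear symmx R k -> 'rV[R]_d}.
Hypothesis affL : affine_subspace L.
Hypothesis pi_ge0 : forall Q i, psd_cone R k Q -> L Q -> 0 <= pi Q 0 i.
Hypothesis pi_unit : forall i,
  exists A, [/\ psd_cone R k A, L A & pi A = delta_mx 0 i].

(** The chain is climbed from the fibre over 0: each step frees one more coordinate, the last one
    still forced to vanish, by averaging with a preimage of its unit vector. *)
Lemma lift_rank_chain B m : psd_cone R k B -> L B -> pi B = 0 -> (m <= d)%N ->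
  exists P, [/\ psd_cone R k P, L P,
    forall j : 'I_d, (j < d - m)%N -> pi P 0 j = 0 &
    (\rank (symmx_val B) + m <= \rank (symmx_val P))%N].
Proof.
move=> psdB LB piB; elim: m => [_|m IHm ltmd].
  by exists B; split => //; [move=> j _; rewrite piB mxE | rewrite addn0].
have [P [psdP LP piP rkP]] := IHm (ltnW ltmd).
have lti : (d - m.+1 < d)%N by rewrite ltn_subrL /= (leq_ltn_trans _ ltmd).
pose i := Ordinal lti.
have [A [psdA LA piA]] := pi_unit i.
exists ((1 - 2^-1) *: P + 2^-1 *: A); split.
- by apply: psd_conv => //; apply/andP; split; lra.
- exact: affL.
- move=> j ltj; rewrite linearD /= !linearZ /= piA !mxE.
  rewrite piP; last by apply: leq_trans ltj _; rewrite leq_sub2l.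
  have -> : (j == i) = false by rewrite -val_eqE /= ltn_eqF.
  by rewrite andbF !mulr0 addr0.
- rewrite addnS; apply: leq_ltn_trans rkP _.
  apply: (@face_rank_ltn _ _ _ L pi i) => //.
  + by move=> Q; exact: pi_ge0.
  + by apply: piP; rewrite /= ltn_sub2l.
  + by rewrite piA mxE !eqxx.
Qed.

Lemma lift_fiber0_rank B : psd_cone R k B -> L B -> pi B = 0 ->
  (\rank (symmx_val B) + d <= k)%N.
Proof.
move=> psdB LB piB.
have [P [_ _ _ /leq_trans]] := lift_rank_chain B d psdB LB piB (leqnn d).
by apply; exact: rank_leq_row.
Qed.

End Lift.

(** * Points and bounds of the stable set polytope *)

Section StableSetPolytope.
Local Open Scope ring_scope.
Variables (R : realType) (n : nat) (e : rel 'I_n).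

Lemma STAB_sub_box (x : 'rV[R]_n) i : STAB R e x -> 0 <= x 0 i <= 1.
Proof.
apply: (@smallest_sub _ _ _ [set y : 'rV[R]_n | 0 <= y 0 i <= 1]).
  move=> y z t /set_mem /= /andP[y0 y1] /set_mem /= /andP[z0 z1].
  apply/mem_set => /=; rewrite /conv /= !mxE.
  have t0 : 0 <= t%:num by [].
  have t1 : t%:num <= 1 by [].
  by rewrite /unstable.onem; apply/andP; split; nra.
by move=> _ [S _ <-]; rewrite /= mxE ler0n lern1 leq_b1.
Qed.

Lemma char_vec_STAB (S : {set 'I_n}) : stable_set e S -> STAB R e (char_vec R S).
Proof. by move=> stS; apply: sub_gen_smallest; exists S. Qed.

Lemma zero_STAB : STAB R e 0.
Proof.
have -> : 0 = char_vec R (finset.set0 : {set 'I_n}).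
  by apply/rowP => i; rewrite !mxE finset.in_set0.
by apply: char_vec_STAB => i j; rewrite finset.in_set0.
Qed.

Lemma delta_STAB i : irreflexive e -> STAB R e (delta_mx 0 i).
Proof.
move=> e_irr.
have -> : delta_mx 0 i = char_vec R [set i]%SET.
  by apply/rowP => j; rewrite !mxE eqxx finset.in_set1.
by apply: char_vec_STAB => j l /set1P-> /set1P->; rewrite e_irr.
Qed.

End StableSetPolytope.

Theorem theorem5p2 (R : realType) (n : nat) (n_gt0 : (0 < n)%N)
    (e : rel 'I_n) (e_sym : symmetric e) (e_irr : irreflexive e) :
  ~ has_psd_lift n (STAB R e).
Proof.
move=> [L [pi [affL STABE]]].
have piK Q : psd_cone R n Q -> L Q -> STAB R e (pi Q).
  by move=> psdQ LQ; rewrite STABE; exists Q.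
have lift x : STAB R e x -> exists A, [/\ psd_cone R n A, L A & pi A = x].
  by rewrite STABE => -[A [psdA LA] <-]; exists A.
have [B [psdB LB piB]] := lift _ (zero_STAB R n e).
(* The chain has length [n] and ranks are at most [n], so no rank is left for [B]. *)
have B0 : B = 0%R.
  apply/val_inj/eqP; rewrite -[_ == _]mxrank_eq0 -leqn0 -(leq_add2r n) add0n.
  apply: (lift_fiber0_rank R n n L pi) => // [Q i psdQ LQ|i].
    by have /andP[] := STAB_sub_box R n e _ i (piK Q psdQ LQ).
  exact: lift (delta_STAB R n e i e_irr).
pose i := Ordinal n_gt0.
have [A [psdA LA piA]] := lift _ (delta_STAB R n e i e_irr).
(* The line from [B = 0] through [A], taken at parameter 2, stays in [L]; its image has [i]-th
   coordinate 2, outside the unit box. *)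
have L2A : L (2%:R *: A)%R.
  by have := affL B A 2%R LB LA; rewrite B0 GRing.scaler0 add0r.
have psd2A : psd_cone R n (2%:R *: A)%R.
  have -> : (2%:R *: A = A + A)%R by rewrite scaler_nat.
  by move=> x; rewrite /= mulmxDr mulmxDl mxE addr_ge0 //; exact: psdA.
have /andP[_] := STAB_sub_box R n e _ i (piK _ psd2A L2A).
rewrite linearZ /= piA !mxE !eqxx mulr1; lra.
Qed.
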